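(* Let $x=(x_1,\dots,x_l)$ and $y=(y_1,\dots,y_l)$ be $l$-dimensional boxes (arrays of positive integers) with $x_i\ge y_i$ for all $i=1,\dots,l$. Let $X$ be the random variable that assigns to a result of aggregation $x+y\to z$ the number of indices $i$ with $z_i\neq x_i$, and for a positive integer $p$ let $M^p=\sum_{k=1}^{l}k^p\,P(X=k)$ be its $p$-th moment. Then $$M^p=\left.\frac{(u\,\partial_u)^p\,\mathcal{M}(u)}{\mathcal{M}(u)}\right|_{u=2},$$ where $$\mathcal{M}(u)=\prod_{i=1}^{l}\left(1+\frac{y_iu}{x_i-y_i+1}\right)-\prod_{i=1}^{l}\left(1+\frac{(y_i-1)u}{x_i-y_i+1}\right).$$
   Context: An $l$-dimensional box $x=(x_1,\dots,x_l)\in\mathbb{Z}_{>0}^l$ is a Cartesian product of $l$ intervals parallel to the coordinate axes of $\mathbb{R}^l$, with integer side lengths $x_1,\dots,x_l$ (in this order) and with vertices in $\mathbb{Z}^l$. Attachments: keep the box $x$ in a fixed position and translate the box $y$ (without rotation) by lattice vectors. A position of $y$ is an attachment if the two boxes are placed next to each other (disjoint interiors) and their boundaries have at least one common lattice point. The result of the aggregation is the box $z=(z_1,\dots,z_l)$ given by the side lengths of the minimal axis-aligned bounding box of the union; one writes $x+y\to z$. All attachments are assumed equally likely, and $P$ denotes the resulting probability. $\partial_u$ denotes the derivative with respect to $u$, and $(u\partial_u)^p$ the $p$-fold application of the operator $u\,\frac{d}{du}$. The superscript in $M^p$ is an index, not a power. *)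

(* Defs.v *)
From HB Require Import structures.
From mathcomp Require Import all_boot all_order all_algebra finmap.
From mathcomp Require Import all_classical all_reals all_analysis.

Set Implicit Arguments.
Unset Strict Implicit.
Unset Printing Implicit Defensive.

Import Order.TTheory GRing.Theory Num.Theory.
Import numFieldNormedType.Exports.

Local Open Scope classical_set_scope.
Local Open Scope ring_scope.

Definition boundary (T : topologicalType) (A : set T) : set T :=
  closure A `\` interior A.

Definition orthotope (R : realType) (l : nat) (a b : 'rV[R]_l) : set 'rV[R]_l :=
  [set p | forall i, a 0 i <= p 0 i <= b 0 i].

Definition lattice_point (R : realType) (l : nat) (n : 'rV[int]_l) : 'rV[R]_l :=
  \row_i (n 0 i)%:~R.
Arguments lattice_point R {l} n.

(* [s] is the lexicographically least vertex, [x] the side lengths. *)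
Definition box (R : realType) (l : nat) (s : 'rV[int]_l) (x : 'I_l -> nat) :
    set 'rV[R]_l :=
  orthotope (lattice_point R s) (lattice_point R (s + \row_i (x i)%:Z)).
Arguments box R {l} s x.

(* The box [x] is fixed with its least vertex at the origin, so a position of
   [y] is the vector [t] translating it from the origin. *)
Definition attachments (R : realType) (l : nat) (x y : 'I_l -> nat) :
    set 'rV[int]_l :=
  [set t | interior (box R 0 x) `&` interior (box R t y) = set0 /\
           exists n : 'rV[int]_l,
             boundary (box R 0 x) (lattice_point R n) /\
             boundary (box R t y) (lattice_point R n)].
Arguments attachments R {l} x y.

Definition bounding_box (R : realType) (l : nat) (U : set 'rV[R]_l)
    (s : 'rV[int]_l) (z : 'I_l -> nat) : Prop :=
  U `<=` box R s z /\
  forall a b : 'rV[R]_l, U `<=` orthotope a b -> box R s z `<=` orthotope a b.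

Definition aggregation (R : realType) (l : nat) (x y : 'I_l -> nat)
    (t : 'rV[int]_l) (z : 'I_l -> nat) : Prop :=
  exists s, bounding_box (box R 0 x `|` box R t y) s z.
Arguments aggregation R {l} x y t z.

(* Probability that the result [z] of [x + y -> z] lies in [E]. The set of
   attachments is finite, so [fset_set] does not collapse it to [fset0]. *)
Definition prob (R : realType) (l : nat) (x y : 'I_l -> nat)
    (E : set ('I_l -> nat)) : R :=
  (#|` fset_set [set t | attachments R x y t /\
                         exists2 z, aggregation R x y t z & E z]|)%:R /
  (#|` fset_set (attachments R x y)|)%:R.
Arguments prob R {l} x y E.

Definition num_changed (l : nat) (x z : 'I_l -> nat) : nat :=
  #|[set i | z i != x i]%SET|.

Definition moment (R : realType) (l : nat) (x y : 'I_l -> nat) (p : nat) : R :=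
  \sum_(1 <= k < l.+1)
    (k ^ p)%:R * prob R x y [set z | num_changed x z = k].
Arguments moment R {l} x y p.

Definition euler_op (R : realType) (f : R -> R) : R -> R :=
  fun u => u * derive1 f u.

Definition genfun (R : realType) (l : nat) (x y : 'I_l -> nat) (u : R) : R :=
  \prod_(i < l) (1 + (y i)%:R * u / ((x i)%:R - (y i)%:R + 1)) -
  \prod_(i < l) (1 + ((y i)%:R - 1) * u / ((x i)%:R - (y i)%:R + 1)).
Arguments genfun R {l} x y u.

(* Main.v *)
(* An attachment is a translation [t] with [- y i <= t i <= x i] for all [i] and
   equality at one of the two ends for some [i]; coordinate [i] of the bounding
   box differs from [x i] unless [0 <= t i <= x i - y i]. So each coordinate has
   [x i - y i + 1] unchanged values and [2 * y i] changed ones, and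
   [2 * (y i - 1)] changed ones if the two ends are excluded. Marking changed
   coordinates by [v], the attachments have the generating polynomial
   [\prod_i (x i - y i + 1 + 2 y i v) - \prod_i (x i - y i + 1 + 2 (y i - 1) v)],
   which is a constant multiple of [genfun] at [u = 2 v]; the Euler operator
   multiplies the coefficient of [u ^ k] by [k]. *)
Require Import Defs.
From mathcomp Require Import all_boot all_order all_algebra finmap.
From mathcomp Require Import all_classical all_reals all_analysis.
From mathcomp Require Import zify ring lra.
Import Order.TTheory GRing.Theory Num.Theory.
Import numFieldNormedType.Exports.
Local Open Scope ring_scope.

Set Implicit Arguments.
Unset Strict Implicit.

(** * Interior and boundary of orthotopes *)

Lemma interior_orthotope (R : realType) (l : nat) (a b : 'rV[R]_l) :
  interior (orthotope a b) = [set p | forall i, a 0 i < p 0 i < b 0 i]%classic.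
Proof.
apply/seteqP; split => [p|p pab].
  rewrite /interior /= => /nbhs_ballP[e /= e0 pab] i.
  (* Balls are taken in the max norm, so all coordinates can be shifted by [c] at once; the shifts
     by [e / 2] and [- (e / 2)] make both bounds strict. *)
  have pushP c : `|c| < e -> orthotope a b (p + const_mx c).
    move=> ce; apply: pab; split=> // u v.
    rewrite /ball/= !mxE.
    by rewrite opprD addrA subrr sub0r normrN.
  have e2 : `|e / 2| < e by rewrite ger0_norm; lra.
  have /andP[_] := pushP _ e2 i; rewrite !mxE => pb.
  have /andP[+ _] := pushP (- (e / 2)) ltac:(by rewrite normrN) i.
  by rewrite !mxE; lra.
suff : nbhs p (fun q : 'rV[R]_l => forall i, a 0 i <= q 0 i <= b 0 i) by [].
(* The coordinates are finite in number, so a neighbourhood for each of them suffices. *)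
refine (@filter_forall _ _ (fun i (q : 'rV[R]_l) => a 0 i <= q 0 i <= b 0 i)
  (nbhs p) _ _) => i.
have : \forall x \near nbhs (p 0 i), a 0 i < x < b 0 i.
  have /andP[pa pb] := pab i.
  near=> x; apply/andP; split; near: x; [exact: lt_nbhsr|exact: lt_nbhsl].
move=> /(@coord_continuous _ _ _ 0 i p); apply: (@filterS _ (nbhs p)) => q /=.
by move=> /andP[? ?]; rewrite !ltW.
Unshelve. all: by end_near.
Qed.

Lemma closed_orthotope (R : realType) (l : nat) (a b : 'rV[R]_l) :
  closed (orthotope a b).
Proof.
have -> : orthotope a b = (\bigcap_(i in setT)
    ([set p : 'rV_l | a 0 i <= p 0 i] `&` [set p | p 0 i <= b 0 i]))%classic.
  apply/seteqP; split => [p pab i _|p pab i]; first by have /andP[] := pab i.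
  by have [] := pab i I; rewrite /= => -> ->.
apply: closed_bigI => i _; apply: closedI.
- apply: (@preimage_closed _ _ (fun p : 'rV[R]_l => p 0 i)
             [set x | a 0 i <= x]%classic).
    by move=> q _; exact: coord_continuous.
  exact: closed_ge.
- apply: (@preimage_closed _ _ (fun p : 'rV[R]_l => p 0 i)
             [set x | x <= b 0 i]%classic).
    by move=> q _; exact: coord_continuous.
  exact: closed_le.
Qed.

Lemma boundary_orthotope (R : realType) (l : nat) (a b p : 'rV[R]_l) :
  boundary (orthotope a b) p <->
  orthotope a b p /\ exists i, (p 0 i == a 0 i) || (p 0 i == b 0 i).
Proof.
rewrite /boundary /setD /= interior_orthotope.
rewrite -(proj1 (closure_id _) (@closed_orthotope R l a b)).
split=> [[pab /existsNP[i /negP nab]]|[pab [i pi]]]; split=> //.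
  by exists i; have /andP[] := pab i; move: nab; lra.
by move=> /(_ i); move: pi => /orP[] /eqP ->; rewrite ltxx ?andbF.
Qed.

(** * Boxes and attachments in integer coordinates *)

Lemma boxP (R : realType) (l : nat) (s : 'rV[int]_l) (x : 'I_l -> nat)
    (p : 'rV[R]_l) :
  box R s x p <->
  forall i, (s 0 i)%:~R <= p 0 i <= (s 0 i + (x i)%:Z)%:~R.
Proof. by split=> h i; move: (h i); rewrite !mxE. Qed.

Lemma box_lattice_point (R : realType) (l : nat) (s n : 'rV[int]_l)
    (x : 'I_l -> nat) :
  box R s x (lattice_point R n) <->
  forall i, s 0 i <= n 0 i <= s 0 i + (x i)%:Z.
Proof.
by split=> h i; move: (h i); rewrite !mxE !ler_int.
Qed.

Lemma boundary_box_lattice_point (R : realType) (l : nat) (s n : 'rV[int]_l)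
    (x : 'I_l -> nat) :
  boundary (box R s x) (lattice_point R n) <->
  (forall i, s 0 i <= n 0 i <= s 0 i + (x i)%:Z) /\
  exists i, (n 0 i == s 0 i) || (n 0 i == s 0 i + (x i)%:Z).
Proof.
rewrite boundary_orthotope -[orthotope _ _ _]/(box R s x _) box_lattice_point.
split=> -[h [i hi]]; split=> //; exists i; move: hi;
  by rewrite !mxE !eqr_int.
Qed.

Lemma interior_boxes_disjoint (R : realType) (l : nat) (s t : 'rV[int]_l)
    (x y : 'I_l -> nat) :
  (forall i, (0 < x i)%N) -> (forall i, (0 < y i)%N) ->
  (interior (box R s x) `&` interior (box R t y) = set0)%classic <->
  exists i, (t 0 i + (y i)%:Z <= s 0 i) || (s 0 i + (x i)%:Z <= t 0 i).
Proof.
move=> x0 y0; rewrite !interior_orthotope; split=> [|[i sti]].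
  apply: contraPP => /forallNP nst; apply/eqP/set0P.
  (* When no coordinate separates the boxes, their side intervals overlap in [lo i < hi i] for every
     [i], and the midpoints form a common interior point. *)
  pose lo i : R := (Num.max (s 0 i) (t 0 i))%:~R.
  pose hi i : R := (Num.min (s 0 i + (x i)%:Z) (t 0 i + (y i)%:Z))%:~R.
  have lohi i : lo i < hi i.
    by rewrite ltr_int; move: (nst i) (x0 i) (y0 i) => /negP; lia.
  have H i : [/\ (s 0 i)%:~R <= lo i, (t 0 i)%:~R <= lo i,
      hi i <= (s 0 i + (x i)%:Z)%:~R & hi i <= (t 0 i + (y i)%:Z)%:~R].
    by rewrite !ler_int; split; lia.
  exists (\row_i ((lo i + hi i) / 2)).
  by split=> i; rewrite !mxE; have := lohi i; have [] := H i; lra.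
rewrite -subset0 => p /= [/(_ i) + /(_ i)]; rewrite !mxE.
by move: sti; rewrite -!(ler_int R); lra.
Qed.

(** A common lattice point bounds every [t 0 i] on both sides; disjoint interiors give a coordinate
    where one box lies beyond the other, and there a bound is attained. *)
Lemma attachmentsP (R : realType) (l : nat) (x y : 'I_l -> nat)
    (t : 'rV[int]_l) :
  (forall i, (0 < x i)%N) -> (forall i, (0 < y i)%N) ->
  attachments R x y t <->
  (forall i, - (y i)%:Z <= t 0 i <= (x i)%:Z) /\
  exists i, (t 0 i == - (y i)%:Z) || (t 0 i == (x i)%:Z).
Proof.
move=> x0 y0; rewrite /attachments /= interior_boxes_disjoint //; split.
  move=> [[i ti] [n [/boundary_box_lattice_point[nx _]
                     /boundary_box_lattice_point[ny _]]]].
  have tr j : - (y j)%:Z <= t 0 j <= (x j)%:Z.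
    by move: (nx j) (ny j); rewrite !mxE; lia.
  split=> //; exists i; move: (tr i) ti; rewrite !mxE; lia.
move=> [tr [i ti]]; split.
  by exists i; move: ti; rewrite !mxE; lia.
(* The least vertex of the intersection of the boxes; its coordinate [i] is an end of both side
   intervals. *)
exists (\row_j Num.max 0 (t 0 j)).
split; apply/boundary_box_lattice_point; split.
- by move=> j; move: (tr j); rewrite !mxE; lia.
- by exists i; move: ti (x0 i) (y0 i); rewrite !mxE; lia.
- by move=> j; move: (tr j); rewrite !mxE; lia.
- by exists i; move: ti (x0 i) (y0 i); rewrite !mxE; lia.
Qed.

(** * Bounding boxes and results of aggregation *)

Lemma vertexE (l : nat) (s : 'rV[int]_l) (z : 'I_l -> nat) (i : 'I_l) :
  (s + \row_j (z j)%:Z) 0 i = s 0 i + (z i)%:Z.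
Proof. by rewrite !mxE. Qed.

Lemma box_subset (R : realType) (l : nat) (s s' : 'rV[int]_l)
    (z z' : 'I_l -> nat) :
  (box R s z `<=` box R s' z')%classic ->
  forall i, s' 0 i <= s 0 i /\ s 0 i + (z i)%:Z <= s' 0 i + (z' i)%:Z.
Proof.
move=> sub i; split.
  have /sub/box_lattice_point/(_ i) : box R s z (lattice_point R s).
    by apply/box_lattice_point => j; lia.
  by lia.
have /sub/box_lattice_point/(_ i) :
    box R s z (lattice_point R (s + \row_i (z i)%:Z)).
  by apply/box_lattice_point => j; rewrite vertexE; lia.
by rewrite vertexE; lia.
Qed.

(** Two minimal boxes contain each other; hence the relation [aggregation] determines its result. *)
Lemma bounding_box_unique (R : realType) (l : nat) (U : set 'rV[R]_l)
    (s s' : 'rV[int]_l) (z z' : 'I_l -> nat) :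
  bounding_box U s z -> bounding_box U s' z' -> z =1 z'.
Proof.
move=> [Us ms] [Us' ms'] i.
have [] := box_subset (ms _ _ Us') i; have [] := box_subset (ms' _ _ Us) i.
by lia.
Qed.

(** Length of the hull of the intervals from [0] to [x i] and from [t 0 i] to [t 0 i + y i]. The
    difference is nonnegative, so [absz] only changes its type. *)
Definition aggregate (l : nat) (x y : 'I_l -> nat) (t : 'rV[int]_l) (i : 'I_l) :
    nat :=
  absz (Num.max (x i)%:Z (t 0 i + (y i)%:Z) - Num.min 0 (t 0 i))%R.

Lemma bounding_box_aggregate (R : realType) (l : nat) (x y : 'I_l -> nat)
    (t : 'rV[int]_l) :
  bounding_box (box R 0 x `|` box R t y)%classic
    (\row_i Num.min 0 (t 0 i)) (aggregate x y t).
Proof.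
pose lo i := Num.min 0 (t 0 i).
pose hi i := Num.max (x i)%:Z (t 0 i + (y i)%:Z).
have zE i : lo i + (aggregate x y t i)%:Z = hi i.
  by rewrite /aggregate /lo /hi; lia.
split=> [p|a b ab p /boxP + i].
  move=> pxy; apply/boxP => i; rewrite mxE -/(lo i) zE.
  case: pxy => /boxP/(_ i); rewrite ?mxE => /andP[p1 p2]; apply/andP; split.
  - by apply: le_trans p1; rewrite ler_int /lo; lia.
  - by apply: le_trans p2 _; rewrite ler_int /hi; lia.
  - by apply: le_trans p1; rewrite ler_int /lo; lia.
  - by apply: le_trans p2 _; rewrite ler_int /hi; lia.
move=> /(_ i); rewrite mxE -/(lo i) zE => /andP[p1 p2].
(* Each of [lo i] and [hi i] is a coordinate of the least or greatest vertex of one of the boxes, so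
   testing these four vertices suffices. *)
have X (n : 'rV_l) : box R 0 x (lattice_point R n) -> a 0 i <= (n 0 i)%:~R <= b 0 i.
  by move=> nx; have := ab _ (or_introl nx) i; rewrite !mxE.
have Y (n : 'rV_l) : box R t y (lattice_point R n) -> a 0 i <= (n 0 i)%:~R <= b 0 i.
  by move=> ny; have := ab _ (or_intror ny) i; rewrite !mxE.
have /andP[x1 _] : a 0 i <= ((0 : 'rV_l) 0 i)%:~R <= b 0 i.
  by apply: X; apply/box_lattice_point => j; rewrite !mxE; lia.
have /andP[_ x2] : a 0 i <= ((\row_j (x j)%:Z : 'rV_l) 0 i)%:~R <= b 0 i.
  by apply: X; apply/box_lattice_point => j; rewrite !mxE add0r lexx andbT.
have /andP[y1 _] : a 0 i <= (t 0 i)%:~R <= b 0 i.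
  by apply: Y; apply/box_lattice_point => j; lia.
have /andP[_ y2] : a 0 i <= ((t + \row_j (y j)%:Z) 0 i)%:~R <= b 0 i.
  by apply: Y; apply/box_lattice_point => j; rewrite vertexE; lia.
rewrite vertexE in y2; rewrite !mxE in x1 x2; apply/andP; split.
  have [E|E] : lo i = 0 \/ lo i = t 0 i by rewrite /lo; lia.
    by apply: le_trans p1; rewrite E.
  by apply: le_trans p1; rewrite E.
have [E|E] : hi i = (x i)%:Z \/ hi i = t 0 i + (y i)%:Z by rewrite /hi; lia.
  by apply: le_trans p2 _; rewrite E.
by apply: le_trans p2 _; rewrite E.
Qed.

Lemma num_changed_aggregation (R : realType) (l : nat) (x y : 'I_l -> nat)
    (t : 'rV[int]_l) (k : nat) :
  (exists2 z, aggregation R x y t z & num_changed x z = k) <->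
  num_changed x (aggregate x y t) = k.
Proof.
split=> [[z [s zP] <-]|<-]; last first.
  by exists (aggregate x y t) => //; eexists; exact: bounding_box_aggregate.
congr #|pred_of_set _|; apply/setP => i; rewrite !inE.
by rewrite (bounding_box_unique zP (bounding_box_aggregate R x y t)).
Qed.

(** The hull contains the side interval of [x], so it has the same length exactly when the side
    interval of [y] lies inside. *)
Lemma aggregate_unchanged (l : nat) (x y : 'I_l -> nat) (t : 'rV[int]_l)
    (i : 'I_l) :
  (y i <= x i)%N ->
  (aggregate x y t i == x i :> nat) = (0 <= t 0 i <= (x i)%:Z - (y i)%:Z).
Proof. by rewrite /aggregate; lia. Qed.

(** * Counting attachments by finite codes *)

(* Attachments are encoded by the nonnegative offsets [f i = t 0 i + y i]; the
   bound [m] on offsets only serves to make the type of codes finite. *)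
Definition offset_pos (l m : nat) (y : 'I_l -> nat) (f : {ffun 'I_l -> 'I_m}) :
    'rV[int]_l :=
  \row_i ((f i : nat)%:Z - (y i)%:Z).

(** The codes of attachments: the extreme translations [- y i] and [x i] have offsets [0] and
    [x i + y i]. *)
Definition touching (l m : nat) (x y : 'I_l -> nat) :
    {set {ffun 'I_l -> 'I_m}} :=
  [set f : {ffun 'I_l -> 'I_m} | [forall i, (f i <= x i + y i)%N] &&
     [exists i, (f i == 0 :> nat) || (f i == (x i + y i)%N :> nat)]].

Definition changed_coords (l m : nat) (x y : 'I_l -> nat)
    (f : {ffun 'I_l -> 'I_m}) : nat :=
  #|[set i | ~~ (y i <= f i <= x i)%N]|.

Lemma offset_pos_inj (l m : nat) (y : 'I_l -> nat) :
  injective (@offset_pos l m y).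
Proof.
move=> f g /rowP fg; apply/ffunP => i; apply/val_inj => /=.
by move: (fg i); rewrite !mxE => /addIr[].
Qed.

Lemma offset_posK (l m : nat) (x y : 'I_l -> nat) (t : 'rV[int]_l) :
  (forall i, (x i + y i < m)%N) ->
  (forall i, - (y i)%:Z <= t 0 i <= (x i)%:Z) ->
  exists f : {ffun 'I_l -> 'I_m}, offset_pos y f = t.
Proof.
move=> xym tr; have tm i : (absz (t 0 i + (y i)%:Z)%R < m)%N.
  by move: (xym i) (tr i); lia.
exists [ffun i => Ordinal (tm i)]; apply/rowP => i.
by rewrite mxE ffunE /=; move: (tr i); lia.
Qed.

Lemma attachments_offset_pos (R : realType) (l m : nat) (x y : 'I_l -> nat)
    (f : {ffun 'I_l -> 'I_m}) :
  (forall i, (0 < x i)%N) -> (forall i, (0 < y i)%N) ->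
  attachments R x y (offset_pos y f) <-> f \in touching m x y.
Proof.
move=> x0 y0; rewrite attachmentsP // inE.
have pE i : offset_pos y f 0 i = (f i : nat)%:Z - (y i)%:Z by rewrite mxE.
split=> [[fr [i fi]]|/andP[/forallP fr /existsP[i fi]]].
  apply/andP; split; first by apply/forallP => i0; move: (fr i0); rewrite pE; lia.
  by apply/existsP; exists i; move: fi; rewrite pE; lia.
split; first by move=> j; move: (fr j); rewrite pE; lia.
by exists i; move: fi; rewrite pE; lia.
Qed.

(** The set is the injective image of a finite set of codes, which also shows that it is finite. The
    predicate [P] serves both the numerator and the denominator of [prob]. *)
Lemma card_attachments (R : realType) (l m : nat) (x y : 'I_l -> nat)
    (P : pred 'rV[int]_l) :
  (forall i, (0 < x i)%N) -> (forall i, (0 < y i)%N) ->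
  (forall i, (x i + y i < m)%N) ->
  #|` fset_set [set t | attachments R x y t /\ P t]%classic| =
  #|[set f in touching m x y | P (offset_pos y f)]|.
Proof.
move=> x0 y0 xym; set S := [set f in _ | _]%SET.
have -> : [set t | attachments R x y t /\ P t]%classic =
    [set` [fset offset_pos y f | f in S]%fset]%classic.
  apply/seteqP; split => t /=.
    move=> [tA tP]; have [tr _] := proj1 (attachmentsP R t x0 y0) tA.
    have [f ft] := offset_posK xym tr.
    apply/imfsetP; exists f => //=; rewrite inE ft tP andbT.
    by apply/(attachments_offset_pos R f x0 y0); rewrite ft.
  move=> /imfsetP[f /=]; rewrite inE => /andP[fS fP] ->; split=> //.
  exact/(attachments_offset_pos R f x0 y0).
by rewrite set_fsetK card_imfset ?cardE //; exact: offset_pos_inj.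
Qed.

Lemma num_changed_offset_pos (l m : nat) (x y : 'I_l -> nat)
    (f : {ffun 'I_l -> 'I_m}) :
  (forall i, (y i <= x i)%N) ->
  num_changed x (aggregate x y (offset_pos y f)) = changed_coords x y f.
Proof.
move=> yx; congr #|pred_of_set _|; apply/setP => i; rewrite !inE.
have pE : offset_pos y f 0 i = (f i : nat)%:Z - (y i)%:Z by rewrite mxE.
by rewrite aggregate_unchanged // pE; have := yx i; lia.
Qed.

Lemma prob_num_changed (R : realType) (l m : nat) (x y : 'I_l -> nat)
    (k : nat) :
  (forall i, (0 < x i)%N) -> (forall i, (0 < y i)%N) ->
  (forall i, (y i <= x i)%N) -> (forall i, (x i + y i < m)%N) ->
  prob R x y [set z | num_changed x z = k]%classic =
  #|[set f in touching m x y | changed_coords x y f == k]|%:R /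
  #|touching m x y|%:R.
Proof.
move=> x0 y0 yx xym; rewrite /prob; congr (_%:R / _%:R).
  rewrite -[LHS](_ : #|` fset_set [set t | attachments R x y t /\
      num_changed x (aggregate x y t) == k]%classic| = _).
    rewrite (card_attachments R _ x0 y0 xym); congr #|pred_of_set _|.
    by apply/setP => f; rewrite !inE num_changed_offset_pos.
  congr #|` fset_set _|; apply/seteqP; split => t /= [tA tk]; split=> //.
    by apply/num_changed_aggregation/eqP.
  by apply/eqP; move/num_changed_aggregation: tk.
have -> : attachments R x y = [set t | attachments R x y t /\ predT t]%classic.
  by apply/seteqP; split => t /= => [|[]].
rewrite (card_attachments R _ x0 y0 xym); congr #|pred_of_set _|.
by apply/setP => f; rewrite !inE andbT.
Qed.

(** * The generating polynomial of the number of changed coordinates *)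

(** The factor of a single coordinate: cut the range at [c] and [d]; the middle piece has weight
    [1], the outer two weight [v]. *)
Lemma sum_interval_weight (R : comPzRingType) (v : R) (a b c d m : nat) :
  (a <= c <= d)%N -> (d <= b <= m)%N ->
  \sum_(j < m | (a <= j < b)%N) (if (c <= j < d)%N then 1 else v) =
  (d - c)%:R + ((c - a) + (b - d))%:R * v.
Proof.
move=> /andP[ac cd] /andP[db bm].
rewrite (eq_bigl (fun j : 'I_m => (j < b)%N && (a <= j)%N)); last first.
  by move=> j; rewrite andbC.
rewrite -(big_mkord (fun j => (j < b)%N && (a <= j)%N)
                    (fun j => if (c <= j < d)%N then 1 else v)).
under eq_bigl do rewrite andbC.
rewrite -(big_nat_widen _ _ _ (leq a)) // -(big_nat_widenl _ _ _ predT) //.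
rewrite (big_cat_nat ac) ?(leq_trans cd) //= (big_cat_nat cd) //=.
rewrite (eq_big_nat _ _ (F2 := fun=> v)); last by move=> j ?; case: ifP => //; lia.
rewrite [X in _ + (X + _)](eq_big_nat _ _ (F2 := fun=> 1)); last first.
  by move=> j ->.
rewrite [X in _ + (_ + X)](eq_big_nat _ _ (F2 := fun=> v)); last first.
  by move=> j ?; case: ifP => //; lia.
by rewrite !sumr_const_nat natrD mulrDl !mulr_natl addrCA.
Qed.

Lemma sum_touching (R : comPzRingType) (v : R) (l m : nat)
    (x y : 'I_l -> nat) :
  (forall i, (0 < y i)%N) -> (forall i, (y i <= x i)%N) ->
  (forall i, (x i + y i < m)%N) ->
  \sum_(f in touching m x y) v ^+ changed_coords x y f =
  \prod_i ((x i - y i).+1%:R + (y i).*2%:R * v) -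
  \prod_i ((x i - y i).+1%:R + (y i).-1.*2%:R * v).
Proof.
move=> y0 yx xym.
pose w i (j : 'I_m) : R := if (y i <= j < (x i).+1)%N then 1 else v.
(* [Q0] allows all offsets, [Q1] omits both ends. On either side of the unchanged range this leaves
   [y i] offsets in [Q0] and [y i - 1] in [Q1]. *)
pose Q0 i := [pred j : 'I_m | (0 <= j < (x i + y i).+1)%N].
pose Q1 i := [pred j : 'I_m | (1 <= j < x i + y i)%N].
(* The weight is a product over coordinates, so its sum over a product family factors. *)
have wE (f : {ffun 'I_l -> 'I_m}) : v ^+ changed_coords x y f = \prod_i w i (f i).
  rewrite /w -(eq_bigr _ (fun i _ => if_neg _ _ _)) -big_mkcond /= prodr_const.
  by congr (v ^+ _); apply: eq_card => i; rewrite !inE.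
have -> : \prod_i ((x i - y i).+1%:R + (y i).*2%:R * v) =
    \sum_(f in family Q0) v ^+ changed_coords x y f.
  rewrite (eq_bigr _ (fun f _ => wE f)) -bigA_distr_big_dep; apply: eq_bigr => i _.
  have := yx i; have := y0 i; have := xym i => ? ? ?.
  rewrite sum_interval_weight; [|lia|lia].
  by congr (_%:R + _%:R * _); lia.
have -> : \prod_i ((x i - y i).+1%:R + (y i).-1.*2%:R * v) =
    \sum_(f in family Q1) v ^+ changed_coords x y f.
  rewrite (eq_bigr _ (fun f _ => wE f)) -bigA_distr_big_dep; apply: eq_bigr => i _.
  have := yx i; have := y0 i; have := xym i => ? ? ?.
  rewrite sum_interval_weight; [|lia|lia].
  by congr (_%:R + _%:R * _); lia.
(* The part of the first sum inside [Q1] cancels; what remains are the codes that reach an end in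
   some coordinate. *)
rewrite [X in X - _](bigID (fun f => f \in family Q1)) /=.
rewrite [X in X + _ - _](eq_bigl (fun f => f \in family Q1)); last first.
  move=> f; apply/andP/idP => [[]//|fQ]; split=> //; apply/familyP => i.
  by move/familyP/(_ i): fQ; rewrite !inE; lia.
rewrite addrAC subrr add0r; apply: eq_bigl => f; rewrite inE.
apply/andP/andP => -[/forallP f0 f1]; split.
- by apply/familyP => i; rewrite inE; exact: f0.
- apply/negP => /familyP fQ; move/existsP: f1 => [i fi].
  by move: (fQ i); rewrite inE /=; case/orP: fi => /eqP ->; rewrite ?ltnn ?andbF.
- by apply/forallP => i; have := f0 i; rewrite inE.
- rewrite -[X in is_true X]negbK negb_exists; apply: contra f1 => /forallP nf.
  apply/familyP => i; move: (nf i) (f0 i); rewrite !inE negb_or /= ltnS.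
  by rewrite lt0n ltn_neqAle => /andP[-> ->].
Qed.

(** * The Euler operator and the moments *)

(** Each monomial [u ^+ k] is an eigenvector of the operator with eigenvalue [k]. *)
Lemma euler_op_iter (R : realType) (n p : nat) (c : 'I_n -> R) :
  iter p (@euler_op R) (fun u => \sum_(k < n) c k * u ^+ k) =
  fun u => \sum_(k < n) (k ^ p)%:R * (c k * u ^+ k).
Proof.
elim: p => [|p IH]; first by apply/funext => u; under [RHS]eq_bigr do rewrite mul1r.
rewrite iterS IH; apply/funext => u; rewrite /euler_op derive1E.
have -> : (fun v : R => \sum_(k < n) (k ^ p)%:R * (c k * v ^+ k)) =
    \sum_(k < n) (fun v : R => ((k ^ p)%:R * c k) *: v ^+ k).
  by apply/funext => v; rewrite fct_sumE; apply: eq_bigr => k _; rewrite mulrA.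
have D : is_derive u (1 : R) (\sum_(k < n) (fun v : R => ((k ^ p)%:R * c k) *: v ^+ k))
  (\sum_(k < n) ((k ^ p)%:R * c k) *: ((k%:R * u ^+ k.-1) *: (1 : R))).
  apply: is_derive_sum => k; apply: is_deriveZ.
  by have := @is_deriveX R R id k u 1 1 (is_derive_id u 1); rewrite exprfctE.
rewrite (@derive_val _ _ _ _ _ _ _ D) mulr_sumr.
apply: eq_bigr => k _; rewrite /GRing.scale /= mulr1 expnS.
(* The case [k = 0] is separate because [k.-1] truncates there. *)
by case: (k : nat) => [|k']; rewrite ?mul0r ?mul0n ?mulr0 // natrM /= exprS; ring.
Qed.

(** Pulling [x i - y i + 1] out of each factor leaves [y i * u], which is [2 * y i] times
    [u / 2]. *)
Lemma genfunE (R : realType) (l m : nat) (x y : 'I_l -> nat) (u : R) :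
  (forall i, (0 < y i)%N) -> (forall i, (y i <= x i)%N) ->
  (forall i, (x i + y i < m)%N) ->
  genfun R x y u =
  (\prod_i (x i - y i).+1%:R)^-1 *
  \sum_(f in touching m x y) (u / 2) ^+ changed_coords x y f.
Proof.
move=> y0 yx xym; rewrite sum_touching // mulrBr -!prodfV -!big_split /=.
have dE i : ((x i - y i).+1%:R : R) = (x i)%:R - (y i)%:R + 1.
  by rewrite -natr1 natrB.
have d0 i : (x i)%:R - (y i)%:R + 1 != 0 :> R by rewrite -dE pnatr_eq0.
congr (_ - _); apply: eq_bigr => i _; rewrite dE -muln2 natrM.
  by field.
by rewrite -subn1 natrB //; field.
Qed.

Theorem proposition4p3 (R : realType) (l : nat) (x y : 'I_l -> nat) (p : nat)
  (hl : (0 < l)%N) (hp : (0 < p)%N)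
  (hx : forall i, (0 < x i)%N) (hy : forall i, (0 < y i)%N)
  (hxy : forall i, (y i <= x i)%N) :
  moment R x y p = iter p (@euler_op R) (genfun R x y) 2 / genfun R x y 2.
Proof.
pose m := (\max_i (x i + y i)%N).+1.
have xym i : (x i + y i < m)%N.
  by rewrite ltnS; exact: (@leq_bigmax _ (fun j => (x j + y j)%N) i).
pose N k := #|[set f in touching m x y | changed_coords x y f == k]|.
pose d : R := \prod_i (x i - y i).+1%:R.
have d0 : d != 0 by apply/prodf_neq0 => i _; rewrite pnatr_eq0.
(* Group the codes by their number of changed coordinates, which is at most [l]. *)
have sumE (F : nat -> R) : \sum_(f in touching m x y) F (changed_coords x y f) =
    \sum_(k < l.+1) (N k)%:R * F k.
  have cl (f : {ffun 'I_l -> 'I_m}) : (changed_coords x y f < l.+1)%N.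
    by rewrite ltnS -[X in (_ <= X)%N]card_ord max_card.
  rewrite (partition_big (fun f => Ordinal (cl f)) predT) //=.
  apply: eq_bigr => k _; rewrite mulr_natl -sumr_const.
  apply: eq_big => [f|f /andP[_ /eqP <-]] //.
  by rewrite inE.
have gE : genfun R x y = fun u => \sum_(k < l.+1) (d^-1 * (N k)%:R / 2 ^+ k) * u ^+ k.
  apply/funext => u; rewrite (genfunE u hy hxy xym) (sumE (fun k => (u / 2) ^+ k)).
  rewrite mulr_sumr; apply: eq_bigr => k _; rewrite expr_div_n -/d; ring.
rewrite (genfunE 2 hy hxy xym) -/d divff ?pnatr_eq0 //.
(* At [u = 2] every code has weight [1], so the denominator is [d^-1] times the number of
   attachments. *)
rewrite [X in _ / (_ * X)](eq_bigr (fun=> 1)); last by move=> f _; rewrite expr1n.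
rewrite sumr_const gE euler_op_iter /moment.
have -> : \sum_(k < l.+1) (k ^ p)%:R * (d^-1 * (N k)%:R / 2 ^+ k * 2 ^+ k) =
    d^-1 * \sum_(k < l.+1) (k ^ p)%:R * (N k)%:R.
  rewrite mulr_sumr; apply: eq_bigr => k _.
  by rewrite divfK ?expf_neq0 ?pnatr_eq0 // mulrCA.
(* The factor [d^-1] cancels, and the term [k = 0] vanishes since [p] is positive, as the moment
   sums from [k = 1]. *)
rewrite -mulf_div divff ?invr_eq0 // mul1r big_ord_recl /= exp0n // mul0r add0r.
rewrite big_add1 big_mkord mulr_suml; apply: eq_bigr => k _.
by rewrite (prob_num_changed R _ hx hy hxy xym) mulrA.
Qed.
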